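(* Let $A$ be a commutative ring with unit and let $B$ be a commutative $A$-algebra. Let $I\subseteq B$ be an ideal such that $B/I$ is a finite locally free module over $A$ and let $b\in B$. Consider the fiberwise regular-denominator locus $$U_I(b):=\{P\in\operatorname{Spec}(A)\mid b\otimes 1\in S_{I(B\otimes_A(A_P/PA_P))}\},$$ where $b\otimes 1$ is the image of $b$ under base change to the fiber ring $B\otimes_A(A_P/PA_P)$. Then $U_I(b)$ is open in $\operatorname{Spec}(A)$. In particular, $$U_I(b)=D(\det(\mu_b^I)).$$
   Context: For a commutative ring $R$ and an ideal $L$ of $R$, the regular-denominator set of $L$ is $S_L:=\{r\in R\mid \text{multiplication by } r \text{ on } R/L \text{ is injective}\}$. For $P\in\operatorname{Spec}(A)$, $A_P/PA_P$ is the residue field at $P$, and $I(B\otimes_A(A_P/PA_P))$ is the ideal of $B\otimes_A(A_P/PA_P)$ generated by the image of $I$. The map $\mu_b^I\colon B/I\to B/I$, $x+I\mapsto bx+I$, is regarded as an $A$-linear endomorphism of the finite locally free $A$-module $B/I$ (finitely generated and locally free of finite, possibly non-constant, rank over $A$), and $\det(\mu_b^I)\in A$ is its determinant (defined locally on $\operatorname{Spec}(A)$ by choosing bases; the determinant of the endomorphism of the zero module is $1$). For $g\in A$, $D(g)=\{P\in\operatorname{Spec}(A)\mid g\notin P\}$. *)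

(* Defs.v *)
From HB Require Import structures.
From mathcomp Require Import all_boot all_algebra ring.
From mathcomp Require Import boolp classical_sets filter topology_structure.

Set Implicit Arguments.
Unset Strict Implicit.
Unset Printing Implicit Defensive.

Import GRing.Theory.
Local Open Scope classical_set_scope.
Local Open Scope quotient_scope.
Local Open Scope ring_scope.

(** Rings are [comPzRingType]s, so the zero ring is allowed everywhere (fibers
    and localizations may be zero).  MathComp's algebras are nonzero rings and
    its ideals are proper, so an [A]-algebra [B] is instead a morphism
    [phi : {rmorphism A -> B}], and possibly improper ideals are introduced. *)

HB.mixin Record isMulAbsorbing (R : comPzRingType) (S : R -> bool) := {
  absorb_subproof : forall a x, S x -> S (a * x)
}.

#[short(type="idealType")]
HB.structure Definition Ideal (R : comPzRingType) :=
  {S of GRing.ZmodClosed R S & isMulAbsorbing R S}.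

Lemma idealM (R : comPzRingType) (I : idealType R) a x :
  x \in (I : {pred R}) -> a * x \in (I : {pred R}).
Proof. exact: absorb_subproof. Qed.

Section QuotientRing.
Variables (R : comPzRingType) (I : idealType R).

(* The additive group is the one of MathComp's [{ideal_quot I}], which MathComp
   endows with a multiplication only when [I] is a proper ideal. *)
Definition rquot : Type := Quotient.quot I.

HB.instance Definition _ := GRing.Zmodule.on rquot.

Definition rquot_pi (x : R) : rquot := \pi_(Quotient.quot I) x.

Lemma rquot_ind (P : rquot -> Prop) :
  (forall x, P (rquot_pi x)) -> forall q, P q.
Proof. by move=> h q; rewrite -[q](@reprK _ (Quotient.quot I)); apply: h. Qed.

Lemma rquot_eqP x y : rquot_pi x = rquot_pi y <-> x - y \in (I : {pred R}).
Proof.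
by rewrite Quotient.idealrBE; split=> [h|/eqP h]; first by apply/eqP.
Qed.

Lemma rquot_piD x y : rquot_pi (x + y) = rquot_pi x + rquot_pi y.
Proof. exact: Quotient.pi_add. Qed.

Definition rquot_mul (p q : rquot) : rquot :=
  rquot_pi (repr (p : (Quotient.quot I)) * repr (q : (Quotient.quot I))).

Lemma rquot_piM x y : rquot_mul (rquot_pi x) (rquot_pi y) = rquot_pi (x * y).
Proof.
have r z : repr (rquot_pi z : (Quotient.quot I)) - z \in (I : {pred R}).
  by apply/rquot_eqP; rewrite /rquot_pi reprK.
rewrite /rquot_mul; apply/rquot_eqP.
set x' := repr (rquot_pi x); set y' := repr (rquot_pi y).
have -> : x' * y' - x * y = x' * (y' - y) + y * (x' - x) by ring.
by apply: rpredD; apply: idealM; apply: r.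
Qed.

Lemma rquot_mulA : associative rquot_mul.
Proof.
elim/rquot_ind=> x; elim/rquot_ind=> y; elim/rquot_ind=> z.
by rewrite !rquot_piM mulrA.
Qed.

Lemma rquot_mulC : commutative rquot_mul.
Proof.
by elim/rquot_ind=> x; elim/rquot_ind=> y; rewrite !rquot_piM mulrC.
Qed.

Lemma rquot_mul1 : left_id (rquot_pi 1) rquot_mul.
Proof. by elim/rquot_ind=> x; rewrite rquot_piM mul1r. Qed.

Lemma rquot_mulD : left_distributive rquot_mul +%R.
Proof.
elim/rquot_ind=> x; elim/rquot_ind=> y; elim/rquot_ind=> z.
by rewrite -rquot_piD !rquot_piM mulrDl rquot_piD.
Qed.

HB.instance Definition _ := GRing.Zmodule_isComPzRing.Build rquot
  rquot_mulA rquot_mulC rquot_mul1 rquot_mulD.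

Lemma rquot_pi_zmod_morphism : zmod_morphism rquot_pi.
Proof.
move=> x y; rewrite rquot_piD; congr (_ + _); exact: Quotient.pi_opp.
Qed.

Lemma rquot_pi_monoid_morphism : monoid_morphism rquot_pi.
Proof. by split=> // x y; rewrite -rquot_piM. Qed.

HB.instance Definition _ :=
  GRing.isZmodMorphism.Build R rquot rquot_pi rquot_pi_zmod_morphism.
HB.instance Definition _ :=
  GRing.isMonoidMorphism.Build R rquot rquot_pi rquot_pi_monoid_morphism.

End QuotientRing.

Section GeneratedIdeal.
Variables (R : comPzRingType) (X : set R).

Definition ideal_gen (x : R) : bool :=
  `[< exists n (r a : 'I_n -> R),
        (forall i, X (a i)) /\ x = \sum_(i < n) r i * a i >].

Lemma ideal_gen_absorb a x : ideal_gen x -> ideal_gen (a * x).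
Proof.
move=> /asboolP[n [r [c [Xc ->]]]]; apply/asboolP.
exists n, (fun i => a * r i), c; split=> //.
by rewrite mulr_sumr; apply: eq_bigr => i _; rewrite mulrA.
Qed.

Lemma ideal_gen_zmod : zmod_closed ideal_gen.
Proof.
split=> [|x y].
  apply/asboolP; exists 0%N, (fun=> 0), (fun=> 0).
  by split=> [[]//|]; rewrite big_ord0.
move=> gx /(ideal_gen_absorb (-1)); rewrite mulN1r => gy.
move: gx gy => /asboolP[n [r [a [Xa ->]]]] /asboolP[m [s [c [Xc ->]]]].
apply/asboolP; exists (n + m)%N.
exists (fun i => match split i with inl j => r j | inr j => s j end).
exists (fun i => match split i with inl j => a j | inr j => c j end).
split=> [i|]; first by case: (split i).
rewrite big_split_ord /=; congr (_ + _); apply: eq_bigr => i _.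
  by rewrite (unsplitK (inl i)).
by rewrite (unsplitK (inr i)).
Qed.

HB.instance Definition _ := GRing.isZmodClosed.Build R ideal_gen ideal_gen_zmod.
HB.instance Definition _ := isMulAbsorbing.Build R ideal_gen ideal_gen_absorb.

End GeneratedIdeal.

Record spec (A : comPzRingType) := Spec {
  spec_pred :> A -> bool;
  spec_zmod : zmod_closed spec_pred;
  spec_absorb : forall a x, spec_pred x -> spec_pred (a * x);
  spec_proper : ~~ spec_pred 1;
  spec_prime : forall x y, spec_pred (x * y) -> spec_pred x || spec_pred y
}.

HB.instance Definition _ (A : comPzRingType) (P : spec A) :=
  GRing.isZmodClosed.Build A P (spec_zmod P).
HB.instance Definition _ (A : comPzRingType) (P : spec A) :=
  isMulAbsorbing.Build A P (@spec_absorb A P).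

HB.instance Definition _ (A : comPzRingType) := gen_eqMixin (spec A).
HB.instance Definition _ (A : comPzRingType) := gen_choiceMixin (spec A).

Section Zariski.
Variable A : comPzRingType.

Definition zeros (E : set A) : set (spec A) :=
  [set P : spec A | forall f, E f -> f \in (P : {pred A})].

Definition zariski_open (U : set (spec A)) : Prop :=
  exists E, U = ~` zeros E.

Lemma zariski_openT : zariski_open setT.
Proof.
exists [set 1]; apply/esym; rewrite -subTset => P _ /(_ 1 erefl).
by apply/negP; apply: spec_proper.
Qed.

Lemma zariski_openI : setI_closed zariski_open.
Proof.
move=> U V [E ->] [F ->].
exists [set x | exists e f, [/\ E e, F f & x = e * f]].
rewrite -setCU; congr (~` _); apply/seteqP; split=> P.
  case=> zP _ [e [f [Ee Ff ->]]]; last exact/spec_absorb/zP.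
  by rewrite mulrC; apply/spec_absorb/zP.
move=> zP; apply: contrapT => /not_orP[/existsNP[e /not_implyP[Ee eP]]].
move=> /existsNP[f /not_implyP[Ff fP]].
have /spec_prime/orP[/eP|/fP]// : P (e * f) by apply: zP; exists e, f.
Qed.

Lemma zariski_open_bigU (I : Type) (U : I -> set (spec A)) :
  (forall i, zariski_open (U i)) -> zariski_open (\bigcup_i U i).
Proof.
move=> /choice[E UE]; exists (\bigcup_i E i); apply/seteqP; split=> P.
  by case=> i _; rewrite UE => EP zP; apply: EP => f Ef; apply: zP; exists i.
move=> /existsNP[f /not_implyP[[i _ Eif] fP]]; exists i => //.
by rewrite UE => /(_ f Eif).
Qed.

HB.instance Definition _ := isOpenTopological.Build (spec A)
  zariski_openT zariski_openI zariski_open_bigU.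

Definition basic_open (g : A) : set (spec A) :=
  [set P : spec A | g \notin (P : {pred A})].

End Zariski.

Section Localization.
Variables (A : comPzRingType) (S : mulrClosed A).

Definition denom := {s : A | s \in (S : {pred A})}.

Definition denom1 : denom := exist _ 1 (rpred1 S).
Definition denomM (s t : denom) : denom :=
  exist _ (sval s * sval t) (rpredM (valP s) (valP t)).

Section Module.
Variable M : lmodType A.

Definition loc_rel (p q : M * denom) : bool :=
  `[< exists2 u, u \in (S : {pred A}) &
      (u * sval q.2) *: p.1 = (u * sval p.2) *: q.1 >].

Lemma loc_rel_equiv : equiv_class_of loc_rel.
Proof.
split=> [[x s]|[x s] [y t]|[y t] [x s] [z r]].
- by apply/asboolP; exists 1; rewrite ?rpred1.
- by apply/asbool_equiv_eq; split=> -[u Su e]; exists u.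
move=> /asboolP[/= u Su e] /asboolP[/= v Sv h]; apply/asboolP.
exists (u * v * sval t) => /=; first by rewrite !rpredM ?(valP t).
have -> : u * v * sval t * sval r = (v * sval r) * (u * sval t) by ring.
rewrite -scalerA e scalerA.
have -> : v * sval r * (u * sval s) = (u * sval s) * (v * sval r) by ring.
by rewrite -scalerA h scalerA; congr (_ *: _); ring.
Qed.

Canonical loc_equiv_rel := EquivRelPack loc_rel_equiv.
Canonical loc_enc_mod_rel := defaultEncModRel loc_rel.

Definition loc : Type := {eq_quot loc_rel}.

HB.instance Definition _ := Choice.on loc.

Definition loc_frac (x : M) (s : denom) : loc := \pi_{eq_quot loc_rel} (x, s).

Lemma loc_ind (P : loc -> Prop) : (forall x s, P (loc_frac x s)) -> forall q, P q.
Proof.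
move=> h q; rewrite -[q](@reprK _ {eq_quot loc_rel}).
by case: (repr _) => x s; apply: h.
Qed.

Lemma loc_frac_eqP x s y t : loc_frac x s = loc_frac y t <->
  exists2 u, u \in (S : {pred A}) & (u * sval t) *: x = (u * sval s) *: y.
Proof.
by split=> [/eqmodP/asboolP//|h]; apply/eqmodP/asboolP.
Qed.

Definition loc_frac_repr (q : loc) : M * denom := repr (q : {eq_quot loc_rel}).

Lemma loc_frac_reprP x s : exists2 u, u \in (S : {pred A}) &
  (u * sval s) *: (loc_frac_repr (loc_frac x s)).1 =
  (u * sval (loc_frac_repr (loc_frac x s)).2) *: x.
Proof.
apply/loc_frac_eqP; rewrite /loc_frac -surjective_pairing; exact: reprK.
Qed.

Definition loc_add (p q : loc) : loc :=
  let: (x, s) := loc_frac_repr p in let: (y, t) := loc_frac_repr q in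
  loc_frac (sval t *: x + sval s *: y) (denomM s t).
Definition loc_opp (p : loc) : loc :=
  let: (x, s) := loc_frac_repr p in loc_frac (- x) s.

Lemma loc_addE x s y t :
  loc_add (loc_frac x s) (loc_frac y t) = loc_frac (sval t *: x + sval s *: y) (denomM s t).
Proof.
rewrite /loc_add; move: (loc_frac_reprP x s) (loc_frac_reprP y t).
case: (loc_frac_repr _) => x' s'; case: (loc_frac_repr _) => y' t' [/= u Su e] [v Sv h].
apply/loc_frac_eqP; exists (u * v); rewrite ?rpredM //= !scalerDr !scalerA.
congr (_ + _).
  have -> : u * v * (sval s * sval t) * sval t' = (v * sval t * sval t') * (u * sval s)
    by ring.
  by rewrite -scalerA e scalerA; congr (_ *: _); ring.
have -> : u * v * (sval s * sval t) * sval s' = (u * sval s * sval s') * (v * sval t)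
  by ring.
by rewrite -scalerA h scalerA; congr (_ *: _); ring.
Qed.

Lemma loc_oppE x s : loc_opp (loc_frac x s) = loc_frac (- x) s.
Proof.
rewrite /loc_opp; move: (loc_frac_reprP x s); case: (loc_frac_repr _) => x' s' [u Su e].
by apply/loc_frac_eqP; exists u => //; rewrite !scalerN e.
Qed.

Lemma loc_addA : associative loc_add.
Proof.
elim/loc_ind=> x s; elim/loc_ind=> y t; elim/loc_ind=> z r; rewrite !loc_addE.
apply/loc_frac_eqP; exists 1; rewrite ?rpred1 // !scalerDr !scalerA addrA /=.
by congr (_ *: _ + _ *: _ + _ *: _); ring.
Qed.

Lemma loc_addC : commutative loc_add.
Proof.
elim/loc_ind=> x s; elim/loc_ind=> y t; rewrite !loc_addE.
apply/loc_frac_eqP; exists 1; rewrite ?rpred1 // addrC /=.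
by congr (_ *: _); ring.
Qed.

Lemma loc_add0 : left_id (loc_frac 0 denom1) loc_add.
Proof.
elim/loc_ind=> x s; rewrite loc_addE; apply/loc_frac_eqP; exists 1; rewrite ?rpred1 //=.
by rewrite scaler0 add0r !scalerA; congr (_ *: _); ring.
Qed.

Lemma loc_addN : left_inverse (loc_frac 0 denom1) loc_opp loc_add.
Proof.
elim/loc_ind=> x s; rewrite loc_oppE loc_addE; apply/loc_frac_eqP.
by exists 1; rewrite ?rpred1 //= scalerN addNr !scaler0.
Qed.

HB.instance Definition _ :=
  GRing.isZmodule.Build loc loc_addA loc_addC loc_add0 loc_addN.

Lemma loc_fracD x s y t :
  loc_frac x s + loc_frac y t = loc_frac (sval t *: x + sval s *: y) (denomM s t).
Proof. exact: loc_addE. Qed.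

End Module.

(* The ring S^-1 A is the module S^-1 A with a multiplication. *)
Definition loc_ring : Type := loc A^o.

HB.instance Definition _ := GRing.Zmodule.on loc_ring.

Definition ring_frac (a : A) (s : denom) : loc_ring := loc_frac (a : A^o) s.

Definition loc_scale (M : lmodType A) (p : loc_ring) (q : loc M) : loc M :=
  let: (a, s) := loc_frac_repr p in let: (x, t) := loc_frac_repr q in
  loc_frac ((a : A) *: x) (denomM s t).

Lemma loc_scaleE (M : lmodType A) a s (x : M) t :
  loc_scale (ring_frac a s) (loc_frac x t) = loc_frac (a *: x) (denomM s t).
Proof.
rewrite /loc_scale /ring_frac; move: (loc_frac_reprP (a : A^o) s) (loc_frac_reprP x t).
case: (loc_frac_repr _) => a' s'; case: (loc_frac_repr _) => y t' [/= u Su e] [v Sv h].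
apply/loc_frac_eqP; exists (u * v); rewrite ?rpredM //= !scalerA.
change (u * sval s * (a' : A) = u * sval s' * a) in e.
have -> : u * v * (sval s * sval t) * (a' : A) =
          (u * sval s * (a' : A)) * (v * sval t) by ring.
by rewrite e -scalerA h scalerA; congr (_ *: _); ring.
Qed.

Lemma loc_scaleA (M : lmodType A) (p q : loc_ring) (r : loc M) :
  loc_scale p (loc_scale q r) = loc_scale (loc_scale p (q : loc A^o)) r.
Proof.
elim/loc_ind: p => a s; elim/loc_ind: q => b t; elim/loc_ind: r => x w.
rewrite !loc_scaleE; apply/loc_frac_eqP; exists 1; rewrite ?rpred1 //= !scalerA.
by congr (_ *: _); rewrite /GRing.scale /=; ring.
Qed.

Lemma loc_scale1 (M : lmodType A) : left_id (ring_frac 1 denom1) (@loc_scale M).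
Proof.
elim/loc_ind=> x w; rewrite loc_scaleE; apply/loc_frac_eqP; exists 1.
  by rewrite rpred1.
by rewrite /= !scalerA; congr (_ *: _); ring.
Qed.

Lemma loc_scaleDr (M : lmodType A) (p : loc_ring) :
  {morph @loc_scale M p : q r / q + r}.
Proof.
elim/loc_ind: p => a s; elim/loc_ind=> x t; elim/loc_ind=> y w.
rewrite loc_fracD !loc_scaleE loc_fracD; apply/loc_frac_eqP; exists 1; rewrite ?rpred1 //=.
by rewrite !scalerDr !scalerA; congr (_ *: _ + _ *: _); ring.
Qed.

Lemma loc_scaleDl (M : lmodType A) (q : loc M) :
  {morph (fun p => loc_scale p q) : p r / p + r}.
Proof.
elim/loc_ind: q => x w; elim/loc_ind=> a s; elim/loc_ind=> b t.
rewrite loc_fracD !loc_scaleE loc_fracD; apply/loc_frac_eqP; exists 1; rewrite ?rpred1 //=.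
rewrite !scalerDr !scalerA -!scalerDl; congr (_ *: _); rewrite /GRing.scale /=.
by ring.
Qed.

Definition loc_mul (p q : loc_ring) : loc_ring := loc_scale p (q : loc A^o).

Lemma loc_mulA : associative loc_mul.
Proof. by move=> p q r; apply: loc_scaleA. Qed.

Lemma loc_mulC : commutative loc_mul.
Proof.
elim/loc_ind=> a s; elim/loc_ind=> b t; rewrite /loc_mul !loc_scaleE.
apply/loc_frac_eqP; exists 1; rewrite ?rpred1 //= /GRing.scale /=; ring.
Qed.

Lemma loc_mul1 : left_id (ring_frac 1 denom1) loc_mul.
Proof. exact: loc_scale1. Qed.

Lemma loc_mulDl : left_distributive loc_mul +%R.
Proof. by move=> p q r; apply: loc_scaleDl. Qed.

HB.instance Definition _ := GRing.Zmodule_isComPzRing.Build loc_ring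
  loc_mulA loc_mulC loc_mul1 loc_mulDl.

HB.instance Definition _ (M : lmodType A) :=
  GRing.Zmodule_isLmodule.Build loc_ring (loc M)
    (@loc_scaleA M) (@loc_scale1 M) (@loc_scaleDr M) (@loc_scaleDl M).

Definition loc_map (a : A) : loc_ring := ring_frac a denom1.

Lemma loc_map_zmod_morphism : zmod_morphism loc_map.
Proof.
move=> a b; rewrite /loc_map /ring_frac.
have -> : - loc_frac (b : A^o) denom1 = loc_frac (- b : A^o) denom1 by exact: loc_oppE.
rewrite loc_fracD; apply/loc_frac_eqP; exists 1; rewrite ?rpred1 //= /GRing.scale /=.
by ring.
Qed.

Lemma loc_map_monoid_morphism : monoid_morphism loc_map.
Proof.
split=> // a b; apply/esym/(etrans (loc_scaleE _ _ _ _)).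
by apply/loc_frac_eqP; exists 1; rewrite ?rpred1 //= /GRing.scale /=; ring.
Qed.

HB.instance Definition _ :=
  GRing.isZmodMorphism.Build A loc_ring loc_map loc_map_zmod_morphism.
HB.instance Definition _ :=
  GRing.isMonoidMorphism.Build A loc_ring loc_map loc_map_monoid_morphism.

(* The endomorphism x/s |-> u(x)/s of S^-1 M. *)
Definition loc_end (M : lmodType A) (u : {linear M -> M}) (q : loc M) : loc M :=
  let: (x, s) := loc_frac_repr q in loc_frac (u x) s.

Lemma loc_endE (M : lmodType A) (u : {linear M -> M}) x s :
  loc_end u (loc_frac x s) = loc_frac (u x) s.
Proof.
rewrite /loc_end; move: (loc_frac_reprP x s); case: (loc_frac_repr _) => y t [v Sv e].
by apply/loc_frac_eqP; exists v => //; rewrite -!linearZ /= e.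
Qed.

End Localization.

Section ResidueField.
Variables (A : comPzRingType) (P : spec A).

Definition prime_compl : {pred A} := fun a => a \notin (P : {pred A}).

Lemma prime_compl_mulr_closed : mulr_closed prime_compl.
Proof.
split=> [|a b aP bP]; first exact: spec_proper.
by apply/negP => /spec_prime/orP[]; apply/negP.
Qed.

HB.instance Definition _ :=
  GRing.isMulClosed.Build A prime_compl prime_compl_mulr_closed.

Definition loc_prime : Type := @loc_ring A prime_compl.
HB.instance Definition _ := GRing.ComPzRing.on loc_prime.

Definition prime_ext : {pred loc_prime} :=
  ideal_gen [set @loc_map A prime_compl a | a in [set` (P : {pred A})]].
HB.instance Definition _ := Ideal.on prime_ext.

Definition residue_field : Type := rquot prime_ext.
HB.instance Definition _ := GRing.ComPzRing.on residue_field.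

Definition residue_map : A -> residue_field :=
  rquot_pi prime_ext \o @loc_map A prime_compl.
HB.instance Definition _ := GRing.RMorphism.on residue_map.

End ResidueField.

Arguments prime_ext {A} P.

Section LocallyFree.
Variables (A : comPzRingType) (M : lmodType A).

Definition powers (f : A) : {pred A} := fun a => `[< exists n, a = f ^+ n >].

Lemma powers_mulr_closed f : mulr_closed (powers f).
Proof.
split=> [|a b /asboolP[m ->] /asboolP[n ->]]; apply/asboolP.
  by exists 0%N; rewrite expr0.
by exists (m + n)%N; rewrite exprD.
Qed.

HB.instance Definition _ f :=
  GRing.isMulClosed.Build A (powers f) (powers_mulr_closed f).

Definition is_basis (R : comPzRingType) (N : lmodType R) n (e : 'I_n -> N) :=
  forall x, exists! c : 'rV[R]_n, x = \sum_(i < n) c 0 i *: e i.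

Definition finitely_generated :=
  exists n (e : 'I_n -> M), forall x, exists c : 'rV[A]_n,
    x = \sum_(i < n) c 0 i *: e i.

Definition locally_free_finite_rank :=
  forall P : spec A, exists2 f, basic_open f P &
    exists n (e : 'I_n -> @loc A (powers f) M), is_basis e.

Definition finite_locally_free :=
  finitely_generated /\ locally_free_finite_rank.

Definition represents (R : comPzRingType) (N : lmodType R) (u : N -> N)
    n (e : 'I_n -> N) (m : 'M[R]_n) :=
  forall j, u (e j) = \sum_(i < n) m i j *: e i.

(* [d] restricts, on each [basic_open f] over which [M] is free, to the
   determinant of the matrix of [u] in any basis. *)
Definition is_det (u : {linear M -> M}) (d : A) :=
  forall f n (e : 'I_n -> @loc A (powers f) M)
      (m : 'M[@loc_ring A (powers f)]_n),
    is_basis e -> represents (loc_end u) e m ->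
    @loc_map A (powers f) d = \det m.

(* When [M] is finite locally free, there is exactly one [d] with [is_det u d];
   the value 0 is only used for other modules. *)
Definition loc_det (u : {linear M -> M}) : A := xget 0 [set d | is_det u d].

End LocallyFree.

Section Tensor.
Variables (A B C : comPzRingType).
Variables (phi : {rmorphism A -> B}) (psi : {rmorphism A -> C}).

(* A sequence [:: (b1, c1); ...; (bn, cn)] stands for the sum of the bi (x) ci;
   [tens_eq] is the congruence generated by bilinearity. *)
Inductive tens_eq : seq (B * C) -> seq (B * C) -> Prop :=
| TensRefl s : tens_eq s s
| TensSym s t : tens_eq s t -> tens_eq t s
| TensTrans s t r : tens_eq s t -> tens_eq t r -> tens_eq s r
| TensCat s s' t t' :
    tens_eq s s' -> tens_eq t t' -> tens_eq (s ++ t) (s' ++ t')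
| TensCatC s t : tens_eq (s ++ t) (t ++ s)
| TensDl b b' c : tens_eq [:: (b + b', c)] [:: (b, c); (b', c)]
| TensDr b c c' : tens_eq [:: (b, c + c')] [:: (b, c); (b, c')]
| TensZ a b c : tens_eq [:: (phi a * b, c)] [:: (b, psi a * c)]
| Tens0 c : tens_eq [:: (0, c)] [::].

Definition tens_rel s t := `[< tens_eq s t >].

Lemma tens_rel_equiv : equiv_class_of tens_rel.
Proof.
split=> [s|s t|t s r]; first by apply/asboolP; apply: TensRefl.
  by apply/asbool_equiv_eq; split; apply: TensSym.
by move=> /asboolP st /asboolP tr; apply/asboolP; apply: TensTrans st tr.
Qed.

Canonical tens_equiv_rel := EquivRelPack tens_rel_equiv.
Canonical tens_enc_mod_rel := defaultEncModRel tens_rel.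

Definition tensor : Type := {eq_quot tens_rel}.
HB.instance Definition _ := Choice.on tensor.

Definition tsum (s : seq (B * C)) : tensor := \pi_{eq_quot tens_rel} s.
Definition tens (b : B) (c : C) : tensor := tsum [:: (b, c)].

Definition tens_repr (x : tensor) : seq (B * C) :=
  repr (x : {eq_quot tens_rel}).

Lemma tsum_eqP s t : tsum s = tsum t <-> tens_eq s t.
Proof. by split=> [/eqmodP/asboolP//|h]; apply/eqmodP/asboolP. Qed.

Lemma tens_reprP s : tens_eq (tens_repr (tsum s)) s.
Proof. by apply/tsum_eqP; apply: reprK. Qed.

Lemma tsum_ind (P : tensor -> Prop) : (forall s, P (tsum s)) -> forall x, P x.
Proof. by move=> h x; rewrite -[x](@reprK _ {eq_quot tens_rel}); apply: h. Qed.

Definition smul (s t : seq (B * C)) : seq (B * C) :=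
  [seq (p.1 * q.1, p.2 * q.2) | p <- s, q <- t].
Definition sopp (s : seq (B * C)) : seq (B * C) := [seq (- p.1, p.2) | p <- s].

Definition tens_add (x y : tensor) := tsum (tens_repr x ++ tens_repr y).
Definition tens_opp (x : tensor) := tsum (sopp (tens_repr x)).
Definition tens_mul (x y : tensor) := tsum (smul (tens_repr x) (tens_repr y)).

Lemma smul_cat s s' t : smul (s ++ s') t = smul s t ++ smul s' t.
Proof. exact: allpairs_cat. Qed.

Lemma smul1E p t : smul [:: p] t = [seq (p.1 * q.1, p.2 * q.2) | q <- t].
Proof. by rewrite /smul /= cats0. Qed.

Lemma smul_consE p s t : smul (p :: s) t = smul [:: p] t ++ smul s t.
Proof. by rewrite -smul_cat. Qed.

Lemma tens_catAC s t r : tens_eq (s ++ t ++ r) (t ++ s ++ r).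
Proof.
by rewrite !catA; apply: TensCat; [apply: TensCatC | apply: TensRefl].
Qed.

Lemma tens_cat_inter s t r w : tens_eq ((s ++ t) ++ r ++ w) ((s ++ r) ++ t ++ w).
Proof.
by rewrite -!catA; apply: TensCat; [apply: TensRefl | apply: tens_catAC].
Qed.

Lemma tens_map_cat (F G H : B * C -> B * C) t :
  (forall q, tens_eq [:: F q] [:: G q; H q]) ->
  tens_eq (map F t) (map G t ++ map H t).
Proof.
move=> h; elim: t => [|q t IH] /=; first exact: TensRefl.
apply: TensTrans (TensCat (h q) IH) _.
exact: (tens_cat_inter [:: G q] [:: H q]).
Qed.

Lemma tens_map (F G : B * C -> B * C) t :
  (forall q, tens_eq [:: F q] [:: G q]) -> tens_eq (map F t) (map G t).
Proof.
move=> h; elim: t => [|q t IH] /=; first exact: TensRefl.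
exact: (TensCat (h q) IH).
Qed.

Lemma smulC s t : tens_eq (smul s t) (smul t s).
Proof.
elim: s => [|p s IH].
  by have -> : smul t [::] = [::]; [elim: t | apply: TensRefl].
rewrite smul_consE; apply: TensTrans (TensCat (TensRefl _) IH) _.
elim: t {IH} => [|q t IH]; first exact: TensRefl.
rewrite (smul_consE q t s) (smul_consE q t (p :: s)) !smul1E /= -!smul1E.
rewrite mulrC [p.2 * _]mulrC.
apply: (TensCat (s := [:: _]) (s' := [:: _])); first exact: TensRefl.
by apply: TensTrans (tens_catAC _ _ _) _; apply: TensCat IH; apply: TensRefl.
Qed.

Lemma smul_congl s s' t : tens_eq s s' -> tens_eq (smul s t) (smul s' t).
Proof.
elim=> {s s'}.
- by move=> s; apply: TensRefl.
- by move=> s r _; apply: TensSym.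
- by move=> s r w _ h _; apply: TensTrans.
- by move=> s s' r r' _ h _ k; rewrite !smul_cat; apply: TensCat.
- by move=> s r; rewrite !smul_cat; apply: TensCatC.
- move=> b b' c; rewrite smul_consE !smul1E [in X in tens_eq _ X]smul_consE !smul1E.
  by rewrite cats0; apply: tens_map_cat => q; rewrite /= mulrDl; apply: TensDl.
- move=> b c c'; rewrite smul_consE !smul1E [in X in tens_eq _ X]smul_consE !smul1E.
  by rewrite cats0; apply: tens_map_cat => q; rewrite /= mulrDl; apply: TensDr.
- move=> a b c; rewrite !smul1E; apply: tens_map => q /=.
  by rewrite -!mulrA; apply: TensZ.
move=> c; rewrite smul1E; elim: t => [|q t IH] /=; first exact: TensRefl.
by rewrite mul0r; apply: (TensCat (Tens0 _) IH).
Qed.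

Lemma smul_cong s s' t t' :
  tens_eq s s' -> tens_eq t t' -> tens_eq (smul s t) (smul s' t').
Proof.
move=> h k; apply: TensTrans (smul_congl t h) _.
apply: TensTrans (smulC _ _) _; apply: TensTrans (smul_congl _ k) _.
exact: smulC.
Qed.

Lemma sopp_smul s : sopp s = smul [:: (-1, 1)] s.
Proof. by rewrite smul1E; apply: eq_map => q /=; rewrite mulN1r mul1r. Qed.

Lemma tsumD s t : tens_add (tsum s) (tsum t) = tsum (s ++ t).
Proof. by apply/tsum_eqP; apply: TensCat; apply: tens_reprP. Qed.

Lemma tsumM s t : tens_mul (tsum s) (tsum t) = tsum (smul s t).
Proof. by apply/tsum_eqP; apply: smul_cong; apply: tens_reprP. Qed.

Lemma tsumN s : tens_opp (tsum s) = tsum (sopp s).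
Proof.
apply/tsum_eqP; rewrite !sopp_smul.
by apply: smul_cong; [apply: TensRefl | apply: tens_reprP].
Qed.

Lemma tens_addA : associative tens_add.
Proof.
elim/tsum_ind=> s; elim/tsum_ind=> t; elim/tsum_ind=> r.
by rewrite !tsumD catA.
Qed.

Lemma tens_addC : commutative tens_add.
Proof.
elim/tsum_ind=> s; elim/tsum_ind=> t; rewrite !tsumD; apply/tsum_eqP.
exact: TensCatC.
Qed.

Lemma tens_add0 : left_id (tsum [::]) tens_add.
Proof. by elim/tsum_ind=> s; rewrite tsumD. Qed.

Lemma tens_addN : left_inverse (tsum [::]) tens_opp tens_add.
Proof.
elim/tsum_ind=> s; rewrite tsumN tsumD; apply/tsum_eqP.
elim: s => [|[b c] s IH] /=; first exact: TensRefl.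
apply: TensTrans (tens_cat_inter [:: (- b, c)] _ [:: (b, c)] _) _.
apply: (TensCat (s' := [::])) IH.
by apply: TensTrans (TensSym (TensDl _ _ _)) _; rewrite addNr; apply: Tens0.
Qed.

HB.instance Definition _ :=
  GRing.isZmodule.Build tensor tens_addA tens_addC tens_add0 tens_addN.

Lemma tens_mulA : associative tens_mul.
Proof.
elim/tsum_ind=> s; elim/tsum_ind=> t; elim/tsum_ind=> r; rewrite !tsumM.
congr tsum; elim: s => [//|p s IH].
rewrite smul_consE IH (smul_consE p s t) smul_cat; congr (_ ++ _).
rewrite !smul1E; elim: t {IH} => [//|q t IH] /=.
rewrite smul_consE [RHS]smul_consE map_cat IH; congr (_ ++ _).
by rewrite !smul1E -map_comp; apply: eq_map => x /=; rewrite !mulrA.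
Qed.

Lemma tens_mulC : commutative tens_mul.
Proof.
elim/tsum_ind=> s; elim/tsum_ind=> t; rewrite !tsumM; apply/tsum_eqP.
exact: smulC.
Qed.

Lemma tens_mul1 : left_id (tens 1 1) tens_mul.
Proof.
elim/tsum_ind=> s; rewrite tsumM smul1E; congr tsum.
by rewrite -[RHS]map_id; apply: eq_map => -[b c] /=; rewrite !mul1r.
Qed.

Lemma tens_mulDl : left_distributive tens_mul +%R.
Proof.
elim/tsum_ind=> s; elim/tsum_ind=> t; elim/tsum_ind=> r.
by rewrite [_ + _]tsumD !tsumM [_ + _]tsumD smul_cat.
Qed.

HB.instance Definition _ := GRing.Zmodule_isComPzRing.Build tensor
  tens_mulA tens_mulC tens_mul1 tens_mulDl.

End Tensor.

Definition mul_rquot (R : comPzRingType) (L : idealType R) (r : R) :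
  rquot L -> rquot L := fun x => rquot_pi L r * x.

Definition regular_denominators (R : comPzRingType) (L : idealType R) : set R :=
  [set r | injective (mul_rquot (L := L) r)].

(* [B / I] as an [A]-module; [phi] only serves to determine the action. *)
Definition mquot (A B : comPzRingType) (phi : {rmorphism A -> B})
  (I : idealType B) : Type := rquot I.

Section Locus.
Variables (A B : comPzRingType) (phi : {rmorphism A -> B}) (I : idealType B).

Local Notation mquot := (mquot phi I).

HB.instance Definition _ := GRing.Zmodule.on mquot.

Definition mquot_scale (a : A) (x : mquot) : mquot := mul_rquot (phi a) x.

Lemma mquot_scaleA a b x :
  mquot_scale a (mquot_scale b x) = mquot_scale (a * b) x.
Proof. by rewrite /mquot_scale /mul_rquot !rmorphM mulrA. Qed.

Lemma mquot_scale1 : left_id 1 mquot_scale.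
Proof. by move=> x; rewrite /mquot_scale /mul_rquot !rmorph1 mul1r. Qed.

Lemma mquot_scaleDr : right_distributive mquot_scale +%R.
Proof. by move=> a x y; apply: mulrDr. Qed.

Lemma mquot_scaleDl x : {morph mquot_scale^~ x : a b / a + b}.
Proof. by move=> a b; rewrite /mquot_scale /mul_rquot !rmorphD; apply: mulrDl. Qed.

HB.instance Definition _ := GRing.Zmodule_isLmodule.Build A mquot
  mquot_scaleA mquot_scale1 mquot_scaleDr mquot_scaleDl.

Definition mul_endo (b : B) : mquot -> mquot := @mul_rquot B I b.

Lemma mul_endo_is_linear b : linear (mul_endo b).
Proof.
move=> a x y; rewrite /mul_endo /mul_rquot [LHS]mulrDr; congr (_ + _).
exact: mulrCA.
Qed.

HB.instance Definition _ b :=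
  GRing.isLinear.Build A mquot mquot _ (mul_endo b) (mul_endo_is_linear b).

Definition fiber (P : spec A) : Type := tensor phi (residue_map P).
HB.instance Definition _ P := GRing.ComPzRing.on (fiber P).

Definition fiber_map (P : spec A) (b : B) : fiber P :=
  tens phi (residue_map P) b 1.

Definition fiber_ideal (P : spec A) : {pred fiber P} :=
  ideal_gen [set fiber_map P x | x in [set` (I : {pred B})]].
Arguments fiber_ideal P : clear implicits.
HB.instance Definition _ P := Ideal.on (fiber_ideal P).

Definition locus (b : B) : set (spec A) :=
  [set P | regular_denominators (fiber_ideal P) (fiber_map P b)].

End Locus.

Arguments mul_endo {A B} phi I b x.
Arguments fiber_ideal {A B} phi I P.

(* Main.v *)
(** Over a basic open set where [B / I] is free, base change along
    [A -> k(P)] turns [B / I] into [k(P)^n], identifies it with the quotient of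
    the fiber ring by the ideal generated by [I], and turns the multiplication
    by [b] into the reduction of its matrix; over the field [k(P)] this is
    injective exactly when the determinant does not vanish.

    That [loc_det] really is the determinant requires gluing the determinants
    in local bases: the elements [g] such that [g] times the local determinants
    come from an element of [A] form an ideal, and this ideal is contained in
    no prime. *)
Require Import Defs.
From HB Require Import structures.
From mathcomp Require Import all_boot all_algebra ring.
From mathcomp Require Import boolp classical_sets topology_structure.

Set Implicit Arguments.
Unset Strict Implicit.
Unset Printing Implicit Defensive.

Import GRing.Theory.
Local Open Scope classical_set_scope.
Local Open Scope ring_scope.

(** * Bases of modules, and independence of the determinant from the basis *)

Section Bases.
Variable R : comPzRingType.

(** Sylvester's identity: multiplying one block matrix by a unitriangular one on either side gives
    two block triangular products, whose determinants are the two sides. *)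
Lemma det_1addC n k (X : 'M[R]_(n, k)) (Y : 'M[R]_(k, n)) :
  \det (1%:M + X *m Y) = \det (1%:M + Y *m X).
Proof.
have E1 : block_mx 1%:M (- X) Y 1%:M *m block_mx 1%:M X 0 1%:M =
          block_mx 1%:M 0 Y (1%:M + Y *m X).
  rewrite mulmx_block !mulmx1 !mulmx0 !mul1mx !addr0; congr block_mx.
    by rewrite addrC addNr.
  by rewrite addrC.
have E2 : block_mx 1%:M X 0 1%:M *m block_mx 1%:M (- X) Y 1%:M =
          block_mx (1%:M + X *m Y) 0 Y 1%:M.
  rewrite mulmx_block !mulmx1 !mul0mx !mul1mx !add0r; congr block_mx.
  by rewrite addNr.
have D : \det (block_mx 1%:M X 0 1%:M) = 1 :> R by rewrite det_ublock !det1 mulr1.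
have := congr1 determinant E1; have := congr1 determinant E2.
by rewrite !det_mulmx D mul1r mulr1 !det_lblock !det1 mul1r mulr1 => -> ->.
Qed.

Variable N : lmodType R.

Definition free_family n (e : 'I_n -> N) :=
  forall c : 'rV[R]_n, \sum_(i < n) c 0 i *: e i = 0 -> c = 0.

Definition spanning_family n (e : 'I_n -> N) :=
  forall x, exists c : 'rV[R]_n, x = \sum_(i < n) c 0 i *: e i.

Lemma is_basisP n (e : 'I_n -> N) :
  is_basis e <-> spanning_family e /\ free_family e.
Proof.
split=> [be|[se fe] x].
  split=> [x|c c0]; first by have [c [? _]] := be x; exists c.
  have [c' [_ u]] := be 0; transitivity c'; first exact/esym/u.
  by apply: u; rewrite big1 // => i _; rewrite mxE scale0r.
have [c ->] := se x; exists c; split=> // c' h; apply/subr0_eq/fe.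
under eq_bigr do rewrite !mxE scalerBl.
by rewrite sumrB h subrr.
Qed.

Lemma basis_inj n (e : 'I_n -> N) (c c' : 'I_n -> R) : is_basis e ->
  \sum_(i < n) c i *: e i = \sum_(i < n) c' i *: e i -> c =1 c'.
Proof.
move=> /is_basisP[_ fe] h i.
suff /rowP/(_ i) : \row_j (c j - c' j) = 0 by rewrite !mxE => /subr0_eq.
by apply: fe; under eq_bigr do rewrite mxE scalerBl; rewrite sumrB h subrr.
Qed.

Lemma basis_coord n (e : 'I_n -> N) : is_basis e ->
  {k : N -> 'I_n -> R | forall x, x = \sum_(i < n) k x i *: e i}.
Proof.
move=> /is_basisP[se _]; apply: (@cid (N -> 'I_n -> R)).
have /choice[k kE] := se.
by exists (fun x i => k x 0 i).
Qed.

Lemma basis_change n k (e : 'I_n -> N) (e' : 'I_k -> N) : is_basis e ->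
  exists T : 'M[R]_(n, k), forall j, e' j = \sum_(i < n) T i j *: e i.
Proof.
move=> /basis_coord[f fE]; exists (\matrix_(i, j) f (e' j) i) => j.
by rewrite {1}[e' j]fE; apply: eq_bigr => i _; rewrite mxE.
Qed.

Lemma lincomb_mul n k l (e : 'I_n -> N) (e' : 'I_k -> N) (T : 'M[R]_(n, k))
    (U : 'M[R]_(k, l)) j :
  (forall j, e' j = \sum_(i < n) T i j *: e i) ->
  \sum_(i < k) U i j *: e' i = \sum_(i < n) (T *m U) i j *: e i.
Proof.
move=> h; under eq_bigr do rewrite h scaler_sumr.
rewrite exchange_big; apply: eq_bigr => i _; rewrite mxE scaler_suml.
by apply: eq_bigr => r _; rewrite scalerA mulrC.
Qed.

Lemma represents_lincomb (u : {linear N -> N}) n (e : 'I_n -> N) (m : 'M[R]_n) k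
    (e' : 'I_k -> N) (T : 'M[R]_(n, k)) j : represents u e m ->
  (forall j, e' j = \sum_(i < n) T i j *: e i) ->
  u (e' j) = \sum_(i < n) (m *m T) i j *: e i.
Proof.
move=> um h; rewrite h linear_sum -(lincomb_mul _ _ um).
by apply: eq_bigr => i _; rewrite linearZ.
Qed.

(* The sizes of the two bases may differ (if [R] is zero), hence the use of
   [det_1addC] on rectangular change-of-basis matrices. *)
Lemma det_basis (u : {linear N -> N}) n k (e : 'I_n -> N) (e' : 'I_k -> N) m m' :
  is_basis e -> is_basis e' -> represents u e m -> represents u e' m' ->
  \det m = \det m'.
Proof.
move=> be be' um um'.
have [T eT] := basis_change e' be; have [S eS] := basis_change e be'.
have TS : T *m S = 1%:M.
  apply/matrixP => i j; move: i; apply: (basis_inj be).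
  rewrite -(lincomb_mul _ _ eT) -eS (bigD1 j) //= mxE eqxx scale1r big1 ?addr0 //.
  by move=> i /negPf ij; rewrite mxE ij scale0r.
have ST : S *m T = 1%:M.
  apply/matrixP => i j; move: i; apply: (basis_inj be').
  rewrite -(lincomb_mul _ _ eS) -eT (bigD1 j) //= mxE eqxx scale1r big1 ?addr0 //.
  by move=> i /negPf ij; rewrite mxE ij scale0r.
have mT : m *m T = T *m m'.
  apply/matrixP => i j; move: i; apply: (basis_inj be).
  by rewrite -(represents_lincomb _ um eT) -(lincomb_mul _ _ eT) um'.
(* In this shape the outer factors can be exchanged: the result [1 + S *m ((m - 1) *m T)] is [m'] by
   [mT] and [ST]. *)
have -> : m = 1%:M + ((m - 1%:M) *m T) *m S.
  by rewrite -mulmxA TS mulmx1 addrC subrK.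
rewrite det_1addC mulmxBl mul1mx mT mulmxBr mulmxA ST mul1mx.
by rewrite addrC subrK.
Qed.

Lemma represents_exists (u : N -> N) n (e : 'I_n -> N) : is_basis e ->
  exists m, represents u e m.
Proof. by move=> be; have [m h] := basis_change (u \o e) be; exists m. Qed.

End Bases.

(** * Localizations and the maps between them *)

Section LocalizationTheory.
Variables (A : comPzRingType).

Section One.
Variables (S : mulrClosed A).
Implicit Types (M : lmodType A).

Lemma loc_fracZ M a (x : M) (s t : denom S) :
  ring_frac a s *: loc_frac x t = loc_frac (a *: x) (denomM s t).
Proof. exact: loc_scaleE. Qed.

Lemma ring_fracM (a b : A) (s t : denom S) :
  ring_frac a s * ring_frac b t = ring_frac (a * b) (denomM s t).
Proof. exact: loc_scaleE. Qed.

Lemma ring_frac_eqP (a b : A) (s t : denom S) : ring_frac a s = ring_frac b t <->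
  exists2 u, u \in (S : {pred A}) & u * sval t * a = u * sval s * b.
Proof. exact: loc_frac_eqP. Qed.

Lemma loc_frac_eq M (x y : M) (s t : denom S) : sval t *: x = sval s *: y ->
  loc_frac x s = loc_frac y t.
Proof.
by move=> h; apply/loc_frac_eqP; exists 1; rewrite ?rpred1 ?mul1r.
Qed.

Lemma ring_frac_eq (a b : A) (s t : denom S) : sval t * a = sval s * b ->
  ring_frac a s = ring_frac b t.
Proof. exact: (@loc_frac_eq A^o). Qed.

Lemma ring_fracK (s : denom S) : ring_frac (sval s) s = 1.
Proof. by apply: (@ring_frac_eq _ 1 s (denom1 S)); rewrite /= mulr1 mul1r. Qed.

Lemma ring_fracE (a : A) (s : denom S) : ring_frac a s = loc_map S a * ring_frac 1 s.
Proof. by rewrite ring_fracM; apply: ring_frac_eq; rewrite /= mulr1 mul1r. Qed.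

Lemma loc_mapK (s : denom S) : loc_map S (sval s) * ring_frac 1 s = 1.
Proof. by rewrite -ring_fracE ring_fracK. Qed.

Lemma loc_frac_sumr M n (x : 'I_n -> M) (s : denom S) :
  loc_frac (\sum_i x i) s = \sum_i loc_frac (x i) s.
Proof.
apply: (big_morph (fun x => loc_frac x s)) => [y z|].
  by rewrite loc_fracD; apply: loc_frac_eq; rewrite /= -scalerDr scalerA.
by apply: loc_frac_eq; rewrite !scaler0.
Qed.

Lemma loc_frac0 M (s : denom S) : loc_frac (0 : M) s = 0.
Proof. by apply: loc_frac_eq; rewrite !scaler0. Qed.

Lemma loc_frac_eq0 M (x : M) (s : denom S) : loc_frac x s = 0 <->
  exists2 u, u \in (S : {pred A}) & u *: x = 0.
Proof.
rewrite -(loc_frac0 M (denom1 S)) loc_frac_eqP; split=> -[u Su /= h].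
  by exists u => //; move: h; rewrite mulr1 scaler0.
by exists u => //; rewrite mulr1 h scaler0.
Qed.

(** The product of all denominators serves; each numerator is multiplied by the denominators of the
    other fractions. *)
Lemma common_denom n (c : 'I_n -> @loc_ring A S) :
  exists s : denom S, exists a : 'I_n -> A, forall i, c i = ring_frac (a i) s.
Proof.
have h i : exists p : A * denom S, c i = ring_frac p.1 p.2.
  by elim/loc_ind: (c i) => a s; exists (a, s).
have /choice[p pE] := h.
have Ss : \prod_i sval (p i).2 \in (S : {pred A}).
  by apply: rpred_prod => i _; apply: (svalP (p i).2).
exists (exist (fun s => s \in (S : {pred A})) _ Ss).
exists (fun i => (p i).1 * \prod_(j | j != i) sval (p j).2) => i.
by rewrite pE; apply: ring_frac_eq; rewrite /= (bigD1 i) //=; ring.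
Qed.

Lemma loc_end_is_linear M (u : {linear M -> M}) : linear (@loc_end A S M u).
Proof.
elim/loc_ind=> a s; elim/loc_ind=> x t; elim/loc_ind=> y w.
rewrite loc_fracZ loc_fracD !loc_endE loc_fracZ loc_fracD.
by rewrite linearD ![u (_ *: _)]linearZ.
Qed.

HB.instance Definition _ M (u : {linear M -> M}) :=
  GRing.isLinear.Build (@loc_ring A S) (@loc A S M) (@loc A S M) _
    (@loc_end A S M u) (@loc_end_is_linear M u).

End One.

Section Inclusion.
Variables (S T : mulrClosed A).
Hypothesis ST : {subset (S : {pred A}) <= (T : {pred A})}.

Definition denom_incl (s : denom S) : denom T := exist _ (sval s) (ST (svalP s)).

(** The canonical map from [S^-1 M] to [T^-1 M]; [loc_inclE] shows that the chosen representative
    does not matter. *)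
Definition loc_incl (M : lmodType A) (q : @loc A S M) : @loc A T M :=
  let: (x, s) := loc_frac_repr q in loc_frac x (denom_incl s).

Lemma loc_inclE (M : lmodType A) (x : M) (s : denom S) :
  loc_incl (loc_frac x s) = loc_frac x (denom_incl s).
Proof.
rewrite /loc_incl; move: (loc_frac_reprP x s); case: (loc_frac_repr _) => y t [v Sv e].
by apply/loc_frac_eqP; exists v; first exact: ST.
Qed.

Lemma loc_incl_is_zmod_morphism (M : lmodType A) : zmod_morphism (@loc_incl M).
Proof.
elim/loc_ind=> x s; elim/loc_ind=> y t.
rewrite [- loc_frac y t]loc_oppE loc_fracD !loc_inclE.
rewrite [- loc_frac y _]loc_oppE loc_fracD.
by apply: loc_frac_eq.
Qed.

HB.instance Definition _ (M : lmodType A) := GRing.isZmodMorphism.Build _ _ (@loc_incl M)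
  (@loc_incl_is_zmod_morphism M).

Definition ring_incl (q : @loc_ring A S) : @loc_ring A T := @loc_incl A^o q.

Lemma ring_inclE a (s : denom S) : ring_incl (ring_frac a s) = ring_frac a (denom_incl s).
Proof. exact: loc_inclE. Qed.

Lemma ring_incl_is_zmod_morphism : zmod_morphism ring_incl.
Proof. exact: loc_incl_is_zmod_morphism. Qed.

Lemma ring_incl_is_monoid_morphism : monoid_morphism ring_incl.
Proof.
split=> [|]; first by rewrite ring_inclE; apply: ring_frac_eq.
elim/loc_ind=> a s; elim/loc_ind=> b t.
rewrite ring_fracM !ring_inclE ring_fracM; exact: ring_frac_eq.
Qed.

HB.instance Definition _ := GRing.isZmodMorphism.Build _ _ ring_incl
  ring_incl_is_zmod_morphism.
HB.instance Definition _ := GRing.isMonoidMorphism.Build _ _ ring_incl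
  ring_incl_is_monoid_morphism.

Lemma ring_incl_map a : ring_incl (loc_map S a) = loc_map T a.
Proof. by rewrite ring_inclE; apply: ring_frac_eq. Qed.

Lemma loc_inclZ (M : lmodType A) c (x : @loc A S M) :
  loc_incl (c *: x) = ring_incl c *: loc_incl x.
Proof.
elim/loc_ind: c => a s; elim/loc_ind: x => x t.
rewrite loc_fracZ ring_inclE !loc_inclE loc_fracZ; exact: loc_frac_eq.
Qed.

Lemma loc_incl_end (M : lmodType A) (u : {linear M -> M}) x :
  loc_incl (loc_end u x) = loc_end u (loc_incl x).
Proof. by elim/loc_ind: x => x s; rewrite !(loc_inclE, loc_endE). Qed.

(** The family spans because [x/t] is [1/t] times the image of [x/1]. For freeness, denominators are
    cleared in a relation; the resulting sum comes from [S^-1 M] and vanishes over [T], so some [v]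
    in [T] already kills it in [S^-1 M], where freeness of [e] applies. *)
Lemma loc_incl_basis (M : lmodType A) n (e : 'I_n -> @loc A S M) :
  is_basis e -> is_basis (fun i => loc_incl (e i)).
Proof.
move=> be; have /is_basisP[_ fe] := be; have [k kE] := basis_coord be.
apply/is_basisP; split.
  elim/loc_ind=> x t; set y := loc_frac x (denom1 S).
  exists (\row_i (ring_frac 1 t * ring_incl (k y i))).
  transitivity (ring_frac 1 t *: loc_incl y).
    by rewrite loc_inclE loc_fracZ; apply: loc_frac_eq; rewrite /= scale1r mulr1.
  rewrite {1}[y]kE raddf_sum scaler_sumr; apply: eq_bigr => i _.
  by rewrite mxE -[RHS]scalerA -loc_inclZ.
move=> c; have [s [a ca]] := common_denom (fun i => c 0 i).
move=> /(congr1 (fun z => loc_map T (sval s) *: z)); rewrite scaler0 scaler_sumr.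
under eq_bigr do rewrite scalerA ca.
have h i : loc_map T (sval s) * ring_frac (a i) s = ring_incl (loc_map S (a i)).
  rewrite ring_fracM ring_incl_map; apply: ring_frac_eq => /=; ring.
under eq_bigr do rewrite h -loc_inclZ.
rewrite -raddf_sum; set z := \sum_(_ < _) _ => z0.
have [v Tv vz] : exists2 v, v \in (T : {pred A}) & loc_map S v *: z = 0.
  move: z0; elim/loc_ind: z => z t.
    move=> /(etrans (esym (loc_inclE z t)))/loc_frac_eq0[v Tv vz].
  by exists v => //; rewrite loc_fracZ vz loc_frac0.
have {}vz i : loc_map S (v * a i) = 0.
  suff /rowP/(_ i) : \row_i loc_map S (v * a i) = 0 by rewrite !mxE.
  apply: fe; apply: etrans vz; rewrite scaler_sumr; apply: eq_bigr => j _.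
  by rewrite mxE scalerA rmorphM.
apply/rowP => i; rewrite ca mxE; apply/(@loc_frac_eq0 T A^o).
have /(@loc_frac_eq0 S A^o)[u Su ui] := vz i.
exists (u * v); first exact: rpredM (ST Su) Tv.
exact: etrans (esym (mulrA u v (a i))) ui.
Qed.

Lemma loc_incl_represents (M : lmodType A) (u : {linear M -> M}) n
    (e : 'I_n -> @loc A S M) m :
  represents (loc_end u) e m ->
  represents (loc_end u) (fun i => loc_incl (e i)) (map_mx ring_incl m).
Proof.
move=> um j; rewrite -loc_incl_end um raddf_sum; apply: eq_bigr => i _.
by rewrite mxE -loc_inclZ.
Qed.

End Inclusion.

End LocalizationTheory.

(** * Existence of primes, and gluing over a cover of the spectrum *)

Section Gluing.
Variable A : comPzRingType.

(** Ideals as sets rather than boolean predicates, so that Zorn's lemma for sets and ideals given by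
    existential conditions fit directly. *)
Definition is_ideal (J : set A) :=
  [/\ J 0, forall x y, J x -> J y -> J (x + y) & forall a x, J x -> J (a * x)].

Lemma is_ideal_ideal_gen (X : set A) : is_ideal [set x | x \in ideal_gen X].
Proof.
split.
- exact: rpred0.
- by move=> x y; apply: rpredD.
- by move=> a x; apply: idealM.
Qed.

Lemma subset_ideal_gen (X : set A) x : X x -> x \in ideal_gen X.
Proof.
move=> Xx; apply/asboolP; exists 1%N, (fun=> 1), (fun=> x).
by rewrite big_ord1 mul1r.
Qed.

Lemma maximal_ideal (J : set A) : is_ideal J -> ~ J 1 ->
  exists2 m, [/\ is_ideal m, J `<=` m & ~ m 1] &
    forall m', is_ideal m' -> m `<=` m' -> ~ m' 1 -> m' `<=` m.
Proof.
move=> idJ J1; pose Q (m : set A) := [/\ is_ideal m, J `<=` m & ~ m 1].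
have [|m [Qm max]] := @Zorn_bigcup A (fun m => m = set0 \/ Q m).
- move=> F FQ totF; have [[m0 Fm0 Qm0]|nQ] := pselect (exists2 m, F m & Q m); last first.
    left; rewrite -subset0 => x [m Fm mx]; have [mE|Qm] := FQ m Fm.
      by move: mx; rewrite mE.
    by apply: nQ; exists m.
  have FQ' m x : F m -> m x -> Q m.
    by move=> Fm mx; have [mE|//] := FQ m Fm; move: mx; rewrite mE.
  have [[m00 _ _] Jm0 _] := Qm0.
  right; split; first split.
  + by exists m0.
  + move=> x y [m Fm mx] [m' Fm' m'y].
    have [/(_ x mx) m'x|/(_ y m'y) my] := totF m m' Fm Fm'.
      by exists m' => //; have [[_ + _] _ _] := FQ' m' y Fm' m'y; apply.
    by exists m => //; have [[_ + _] _ _] := FQ' m x Fm mx; apply.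
  + move=> a x [m Fm mx].
    by exists m => //; have [[_ _ +] _ _] := FQ' m x Fm mx; apply.
  + by move=> x /Jm0 m0x; exists m0.
  + by move=> [m Fm mx]; have [_ _] := FQ' m 1 Fm mx; apply.
(* The maximal element is not the empty set, since [J] is strictly larger. *)
have {}Qm : Q m.
  case: Qm => // m0; have [J0 _ _] := idJ.
  case: (max J); last by right; split=> // x.
  by rewrite m0; split=> // /(_ 0 J0).
exists m => // m' idm' mm' m'1; apply: contrapT => nm.
by case: (max m'); [split | right; case: Qm => _ Jm _; split=> // x /Jm/mm'].
Qed.

(** A maximal ideal containing [J] is prime. *)
Lemma exists_prime (J : set A) : is_ideal J -> ~ J 1 ->
  exists P : spec A, forall x, J x -> x \in (P : {pred A}).
Proof.
move=> idJ J1; have [m [[m0 mD mM] Jm m1] max] := maximal_ideal idJ J1.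
have mN x : m x -> m (- x) by rewrite -mulN1r; apply: mM.
pose p x : bool := `[< m x >].
have zp : zmod_closed p.
  split=> [|x y /asboolP mx /asboolP my]; apply/asboolP => //.
  by apply: mD => //; apply: mN.
have ap a x : p x -> p (a * x) by move=> /asboolP mx; apply/asboolP/mM.
have pp : ~~ p 1 by apply/asboolPn.
suff primep x y : p (x * y) -> p x || p y.
  by exists (Spec zp ap pp primep) => x /Jm mx; apply/asboolP.
move=> /asboolP mxy; apply/orP; have [mx|nmx] := pselect (m x); [left|right].
  exact/asboolP.
apply/asboolP.
(* The ideal generated by [m] and [x]. By maximality it contains 1, and multiplying [1 = a + r * x]
   by [y] puts [y] in [m]. *)
pose m' := [set z | exists2 a, m a & exists r, z = a + r * x].
have m'1 : m' 1.
  apply: contrapT => nm'; apply: nmx; apply: (max m') => //.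
  - split.
    + by exists 0 => //; exists 0; rewrite mul0r addr0.
    + move=> _ _ [a ma [r ->]] [b mb [s ->]]; exists (a + b); first exact: mD.
      by exists (r + s); ring.
    + move=> c _ [a ma [r ->]]; exists (c * a); first exact: mM.
      by exists (c * r); ring.
  - by move=> a ma; exists a => //; exists 0; rewrite mul0r addr0.
  - by exists 0 => //; exists 1; rewrite mul1r add0r.
case: m'1 => a ma [r e].
have -> : y = y * a + r * (x * y).
  by rewrite -[LHS]mulr1 e; ring.
by apply: mD; apply: mM.
Qed.

(** The local-to-global principle used below: an ideal contained in no prime is the unit ideal. *)
Lemma is_ideal1 (J : set A) : is_ideal J ->
  (forall P : spec A, exists2 f, J f & f \notin (P : {pred A})) -> J 1.
Proof.
move=> idJ h; apply: contrapT => /(exists_prime idJ)[P JP].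
by have [f /JP ->] := h P.
Qed.

(** These are the primes of [A] that come from [Spec(S^-1 A)]. *)
Definition avoids (S : {pred A}) (P : spec A) :=
  forall s, s \in S -> s \notin (P : {pred A}).

Lemma avoids_powers f P : basic_open f P -> avoids (powers f) P.
Proof.
move=> fP s /asboolP[n ->]; elim: n => [|n IH].
  by rewrite expr0; apply: (@spec_proper A P).
by rewrite exprS; apply/negP => /spec_prime/orP[]; apply/negP.
Qed.

(** The second hypothesis says that [q i] and [q j] agree on the overlap, the denominators from
    [S i] being cleared by [t]. The ideal [J] consists of the [g] for which all [g * q j] come from
    a single [r]; it is shown to lie in no prime. *)
Lemma loc_glue (I : finType) (S : I -> mulrClosed A)
    (q : forall i, @loc_ring A (S i)) :
  (forall P : spec A, exists i, avoids (S i) P) ->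
  (forall i j r (s : denom (S i)), q i = ring_frac r s ->
    exists2 t, t \in (S i : {pred A}) &
      loc_map (S j) (t * r) = loc_map (S j) (t * sval s) * q j) ->
  exists d, forall j, loc_map (S j) d = q j.
Proof.
move=> cov compat.
pose J := [set g | exists r, forall j, loc_map (S j) r = loc_map (S j) g * q j].
suff [d dq] : J 1 by exists d => j; rewrite dq rmorph1 mul1r.
apply: is_ideal1 => [|P]; first split.
- by exists 0 => j; rewrite !rmorph0 mul0r.
- by move=> x y [r rE] [s sE]; exists (r + s) => j; rewrite !rmorphD /= rE sE mulrDl.
- by move=> a x [r rE]; exists (a * r) => j; rewrite !rmorphM /= rE mulrA.
have [i iP] := cov P; move: (compat i); elim/loc_ind: (q i) => r s compati.
have /choice[t tE] : forall j, exists t, t \in (S i : {pred A}) /\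
    loc_map (S j) (t * r) = loc_map (S j) (t * sval s) * q j.
  by move=> j; have [t St tj] := compati j r s erefl; exists t.
(* One product of multipliers serves all [j] at once; this uses that [I] is finite. *)
have St : \prod_j t j \in (S i : {pred A}).
  by apply: rpred_prod => j _; case: (tE j).
exists (\prod_j t j * sval s); last exact/iP/(rpredM St)/(svalP s).
exists (\prod_j t j * r) => j; rewrite (bigD1 j) //=.
have [_ tj] := tE j.
set w := \prod_(_ | _) _; have -> : t j * w * r = w * (t j * r) by ring.
have -> : t j * w * sval s = w * (t j * sval s) by ring.
by rewrite rmorphM /= tj [in RHS]rmorphM mulrA.
Qed.

End Gluing.

(** * The determinant of an endomorphism of a locally free module *)

Section Determinant.
Variables (A : comPzRingType).

Section Product.
Variables S T : mulrClosed A.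

(** Localizing at these products gives the overlap of the localizations at [S] and at [T]. *)
Definition mulr_set : {pred A} :=
  fun a => `[< exists s t, [/\ s \in (S : {pred A}), t \in (T : {pred A}) & a = s * t] >].

Lemma mulr_set_mulr_closed : mulr_closed mulr_set.
Proof.
split=> [|a b].
  by apply/asboolP; exists 1, 1; rewrite !rpred1 mulr1.
move=> /asboolP[s [t [Ss Tt ->]]] /asboolP[s' [t' [Ss' Tt' ->]]].
by apply/asboolP; exists (s * s'), (t * t'); rewrite !rpredM //; split=> //; ring.
Qed.

HB.instance Definition _ := GRing.isMulClosed.Build A mulr_set mulr_set_mulr_closed.

Lemma mulr_set_l : {subset (S : {pred A}) <= mulr_set}.
Proof. by move=> s Ss; apply/asboolP; exists s, 1; rewrite rpred1 mulr1. Qed.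

Lemma mulr_set_r : {subset (T : {pred A}) <= mulr_set}.
Proof. by move=> t Tt; apply/asboolP; exists 1, t; rewrite rpred1 mul1r. Qed.

End Product.

Variables (M : lmodType A) (u : {linear M -> M}).

(** A relation, because [S^-1 M] may have no basis; [local_det_uniq] makes it single-valued. *)
Definition local_det (S : mulrClosed A) (q : @loc_ring A S) :=
  exists n (e : 'I_n -> @loc A S M) m,
    [/\ is_basis e, represents (loc_end u) e m & q = \det m].

Lemma local_det_uniq (S : mulrClosed A) (q q' : @loc_ring A S) :
  local_det q -> local_det q' -> q = q'.
Proof.
move=> [n [e [m [be em ->]]]] [n' [e' [m' [be' em' ->]]]].
exact: (det_basis (u := loc_end u) be be' em em').
Qed.

Lemma local_det_incl (S T : mulrClosed A) (q : @loc_ring A S)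
    (ST : {subset (S : {pred A}) <= (T : {pred A})}) :
  local_det q -> local_det (ring_incl ST q).
Proof.
move=> [n [e [m [be em ->]]]].
exists n, (fun i => loc_incl ST (e i)), (map_mx (ring_incl ST) m).
by rewrite -det_map_mx; split=> //; [apply: loc_incl_basis|apply: loc_incl_represents].
Qed.

(** Both determinants become the determinant over [mulr_set S T]. The multiplier witnessing their
    equality there is a product [s0 * t0]: [s0] is the required [t], and [t0] witnesses the equality
    over [T]. *)
Lemma local_det_overlap (S T : mulrClosed A) r (s : denom S) (q : @loc_ring A T) :
  local_det (ring_frac r s) -> local_det q ->
  exists2 t, t \in (S : {pred A}) &
    loc_map T (t * r) = loc_map T (t * sval s) * q.
Proof.
move=> /(local_det_incl (@mulr_set_l S T)) dS.
move=> /(local_det_incl (@mulr_set_r S T)); elim/loc_ind: q => r' w dT.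
have := local_det_uniq dS dT; rewrite !ring_inclE.
move=> /ring_frac_eqP[_ /asboolP[s0 [t0 [Ss0 Tt0 ->]]] /= e].
exists s0; rewrite // ring_fracM; apply/ring_frac_eqP; exists t0 => //=.
ring: e.
Qed.

Lemma loc_det_is_det : locally_free_finite_rank M -> is_det u (loc_det u).
Proof.
move=> lf; suff : [set d | is_det u d] !=set0 by apply: xgetPex.
(* The [f] over which a local determinant exists generate the unit ideal, since every prime misses
   one of them. *)
pose X := [set f | exists q : @loc_ring A (powers f), local_det q].
have X1 : 1 \in ideal_gen X.
  apply: (is_ideal1 (is_ideal_ideal_gen X)) => P; have [f fP [n [e be]]] := lf P.
  exists f => //; apply: subset_ideal_gen.
  by have [m em] := represents_exists (loc_end u) be; exists (\det m), n, e, m.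
(* A finite expression of 1 by such elements gives a finite subcover, to which gluing applies. *)
move: X1 => /asboolP[n [r [h [Xh e1]]]].
pose q i := sval (cid (Xh i)); have qE i : local_det (q i) := svalP (cid (Xh i)).
have cov (P : spec A) : exists i, avoids (powers (h i)) P.
  apply: contrapT => /forallNP nP; have /negP[] := @spec_proper A P.
  change (1 \in (P : {pred A})); rewrite e1; apply: rpred_sum => i _.
  by apply: idealM; have [//|/avoids_powers/(nP i)] := boolP (h i \in (P : {pred A})).
have [d dq] : exists d, forall j, loc_map (powers (h j)) d = q j.
  apply: loc_glue cov _ => i j s t qi; apply: local_det_overlap (qE j).
  by rewrite -qi; apply: qE.
exists d => f k e m be em.
have lm : local_det (\det m) by exists k, e, m.
apply/eqP; rewrite -subr_eq0; apply/eqP.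
rewrite -[LHS]mul1r -[in LHS](rmorph1 (@loc_map A (powers f))).
(* The glued [d] must also be right over an arbitrary [f]: the elements killing the difference form
   an ideal, and the overlaps with the finite cover show that it lies in no prime. *)
pose J := [set g | loc_map (powers f) g * (loc_map (powers f) d - \det m) = 0].
apply: (is_ideal1 (J := J)) => [|P]; first split.
- by rewrite /J /= rmorph0 mul0r.
- by move=> x y xE yE; rewrite /J /= rmorphD /= mulrDl xE yE addr0.
- by move=> a x xE; rewrite /J /= rmorphM /= -mulrA xE mulr0.
have [i iP] := cov P.
have [|t St tE] := local_det_overlap (s := denom1 (powers (h i))) (r := d) _ lm.
  by have := qE i; rewrite -dq.
exists t; last exact: iP.
by rewrite /J /= mulrBr -rmorphM /= tE /= mulr1 subrr.
Qed.

End Determinant.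

(** * Regular denominators, and coordinates on a base change modulo the extended ideal *)

Lemma regular_denominatorsP (R : comPzRingType) (L : idealType R) r :
  regular_denominators L r <->
  forall x, r * x \in (L : {pred R}) -> x \in (L : {pred R}).
Proof.
rewrite /regular_denominators /= /mul_rquot; split=> [inj x rx|h].
  suff /rquot_eqP : rquot_pi L x = rquot_pi L 0 by rewrite subr0.
  by apply: inj; rewrite -!rmorphM; apply/rquot_eqP; rewrite mulr0 subr0.
elim/rquot_ind=> x; elim/rquot_ind=> y; rewrite -!rmorphM => /rquot_eqP.
by rewrite -mulrBr => /h/rquot_eqP.
Qed.

Section BaseChange.
Variables (A B C : comPzRingType) (phi : {rmorphism A -> B}) (psi : {rmorphism A -> C}).
Variables (I : idealType B) (S : mulrClosed A) (rho : {rmorphism @loc_ring A S -> C}).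
Hypothesis rho_map : forall a, rho (loc_map S a) = psi a.

Local Notation M := (mquot phi I).
Local Notation F := (tensor phi psi).

Variables (n : nat) (e : 'I_n -> @loc A S M).
Hypothesis be : is_basis e.

(** The projection [rquot_pi I], retyped so that its target carries the [A]-module structure. *)
Definition mquot_pi (b : B) : M := rquot_pi I b.

Lemma mquot_piD b c : mquot_pi (b + c) = mquot_pi b + mquot_pi c.
Proof. exact: rmorphD. Qed.

Lemma mquot_piZ a b : mquot_pi (phi a * b) = a *: mquot_pi b.
Proof. exact: rmorphM. Qed.

Lemma mquot_pi_sum k (b : 'I_k -> B) :
  mquot_pi (\sum_i b i) = \sum_i mquot_pi (b i).
Proof. exact: (raddf_sum (rquot_pi I)). Qed.

Definition loc_pi (b : B) : @loc A S M := loc_frac (mquot_pi b) (denom1 S).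

Lemma loc_piD b c : loc_pi (b + c) = loc_pi b + loc_pi c.
Proof.
rewrite /loc_pi mquot_piD loc_fracD; apply: loc_frac_eq.
by rewrite /= !scale1r mulr1 scale1r.
Qed.

Lemma loc_piZ a b : loc_pi (phi a * b) = loc_map S a *: loc_pi b.
Proof.
rewrite /loc_pi mquot_piZ loc_fracZ; apply: loc_frac_eq.
by rewrite /= !mulr1.
Qed.

Lemma loc_pi0 b : b \in (I : {pred B}) -> loc_pi b = 0.
Proof.
move=> Ib; rewrite /loc_pi (_ : mquot_pi b = 0) ?loc_frac0 //.
have /rquot_eqP b0 : b - 0 \in (I : {pred B}) by rewrite subr0.
exact: etrans b0 (rmorph0 (rquot_pi I)).
Qed.

Let k := sval (basis_coord be).

Let kE x : x = \sum_(i < n) k x i *: e i.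
Proof. exact: (svalP (basis_coord be)). Qed.

Let k_uniq x (c : 'I_n -> _) i : x = \sum_(i < n) c i *: e i -> k x i = c i.
Proof. by move=> h; apply: (basis_inj be); rewrite -kE. Qed.

Let kD x y i : k (x + y) i = k x i + k y i.
Proof.
apply: (k_uniq (c := fun i => k x i + k y i)); under eq_bigr do rewrite scalerDl.
by rewrite big_split -!kE.
Qed.

Let kZ c x i : k (c *: x) i = c * k x i.
Proof.
apply: (k_uniq (c := fun i => c * k x i)); under eq_bigr do rewrite -scalerA.
by rewrite -scaler_sumr -kE.
Qed.

Let k0 i : k 0 i = 0.
Proof. by rewrite -(scale0r (0 : @loc A S M)) kZ mul0r. Qed.

(** The coordinate map to [C^n] sending a pure tensor of [b] and [c] to [c] times the reduced
    coordinates of [b], first on formal sums; [scoord_tens] lets it descend to the tensor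
    product. *)
Definition scoord (s : seq (B * C)) i := \sum_(p <- s) rho (k (loc_pi p.1) i) * p.2.

Lemma scoord_cat s t i : scoord (s ++ t) i = scoord s i + scoord t i.
Proof. exact: big_cat. Qed.

Lemma scoord_tens s t i : tens_eq phi psi s t -> scoord s i = scoord t i.
Proof.
elim=> {s t}.
- by [].
- by [].
- by move=> s t r _ -> _ ->.
- by move=> s s' t t' _ hs _ ht; rewrite !scoord_cat hs ht.
- by move=> s t; rewrite !scoord_cat addrC.
- by move=> b b' c; rewrite /scoord !big_cons !big_nil !addr0 loc_piD kD rmorphD mulrDl.
- by move=> b c c'; rewrite /scoord !big_cons !big_nil !addr0 mulrDr.
- move=> a b c; rewrite /scoord !big_seq1 /= loc_piZ kZ rmorphM rho_map.
  by rewrite mulrCA mulrA.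
- by move=> c; rewrite /scoord big_seq1 big_nil /= loc_pi0 ?rpred0 // k0 rmorph0 mul0r.
Qed.

Definition tcoord (x : F) : 'cV[C]_n := \col_i scoord (tens_repr x) i.

Lemma tcoord_tsum s : tcoord (tsum phi psi s) = \col_i scoord s i.
Proof. by apply/colP => i; rewrite !mxE; exact/scoord_tens/tens_reprP. Qed.

Lemma tsum_add s t : tsum phi psi s + tsum phi psi t = tsum phi psi (s ++ t).
Proof. exact: tsumD. Qed.

Lemma tsum_mul s t : tsum phi psi s * tsum phi psi t = tsum phi psi (smul s t).
Proof. exact: tsumM. Qed.

Lemma tcoordD x y : tcoord (x + y) = tcoord x + tcoord y.
Proof.
elim/tsum_ind: x => s; elim/tsum_ind: y => t.
by rewrite tsum_add !tcoord_tsum; apply/colP => i; rewrite !mxE scoord_cat.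
Qed.

Lemma tcoord0 : tcoord 0 = 0.
Proof. by apply: (addIr (tcoord 0)); rewrite -tcoordD !add0r. Qed.

Lemma tcoord_sum m (x : 'I_m -> F) : tcoord (\sum_i x i) = \sum_i tcoord (x i).
Proof. exact: (big_morph _ tcoordD tcoord0). Qed.

Lemma tens_mul_tsum b s :
  tens phi psi b 1 * tsum phi psi s = tsum phi psi [seq (b * p.1, p.2) | p <- s].
Proof.
rewrite tsum_mul smul1E; congr tsum.
by apply: eq_map => p /=; rewrite mul1r.
Qed.

(** By additivity this reduces to the coordinates of [b * p.1] for each pure tensor, which are [m]
    applied to those of [p.1]. *)
Lemma tcoord_mul b m (x : F) : represents (loc_end (mul_endo phi I b)) e m ->
  tcoord (tens phi psi b 1 * x) = map_mx rho m *m tcoord x.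
Proof.
move=> em; elim/tsum_ind: x => s; rewrite tens_mul_tsum !tcoord_tsum.
apply/colP => i; rewrite !mxE /scoord big_map.
under [RHS]eq_bigr do rewrite !mxE mulr_sumr.
rewrite exchange_big; apply: eq_bigr => p _ /=.
under eq_bigr do rewrite mulrA -rmorphM.
rewrite -mulr_suml -rmorph_sum; congr (rho _ * _).
apply: (k_uniq (c := fun i => \sum_j m i j * k (loc_pi p.1) j)).
have -> : loc_pi (b * p.1) = loc_end (mul_endo phi I b) (loc_pi p.1).
  by rewrite loc_endE; congr loc_frac; apply: rmorphM.
rewrite {1}[loc_pi p.1]kE linear_sum; under eq_bigr do rewrite linearZ /= em scaler_sumr.
rewrite exchange_big; apply: eq_bigr => j _; rewrite scaler_suml.
by apply: eq_bigr => l _; rewrite scalerA mulrC.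
Qed.

Variable L : idealType F.
Hypothesis LE : forall z, (z \in (L : {pred F})) =
  (z \in ideal_gen [set tens phi psi x 1 | x in [set` (I : {pred B})]]).

Lemma tens_addl b b' c : tens phi psi (b + b') c = tens phi psi b c + tens phi psi b' c.
Proof. by rewrite tsum_add; apply/tsum_eqP/TensDl. Qed.

Lemma tens_suml m (b : 'I_m -> B) c :
  tens phi psi (\sum_i b i) c = \sum_i tens phi psi (b i) c.
Proof.
apply: (big_morph (fun b => tens phi psi b c)) => [x y|]; first exact: tens_addl.
exact/tsum_eqP/Tens0.
Qed.

Lemma tens_balanced a b c : tens phi psi (phi a * b) c = tens phi psi b (psi a * c).
Proof. exact/tsum_eqP/TensZ. Qed.

Lemma tens_addr b c c' : tens phi psi b (c + c') = tens phi psi b c + tens phi psi b c'.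
Proof. by rewrite tsum_add; apply/tsum_eqP/TensDr. Qed.

Lemma tens0r b : tens phi psi b 0 = 0.
Proof. by apply: (addIr (tens phi psi b 0)); rewrite -tens_addr !add0r. Qed.

Lemma tensNr b c : tens phi psi b (- c) = - tens phi psi b c.
Proof. by apply: (addIr (tens phi psi b c)); rewrite -tens_addr !addNr tens0r. Qed.

Lemma tens_ideal b c : b \in (I : {pred B}) -> tens phi psi b c \in (L : {pred F}).
Proof.
move=> Ib; have -> : tens phi psi b c = tens phi psi 1 c * tens phi psi b 1.
  by rewrite tsum_mul /smul /= mulr1 mul1r.
by apply: idealM; rewrite LE; apply: subset_ideal_gen; exists b.
Qed.

Lemma tcoord_ideal z : z \in (L : {pred F}) -> tcoord z = 0.
Proof.
rewrite LE => /asboolP[m [r [a [aI ->]]]]; rewrite tcoord_sum big1 // => i _.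
have [x Ix <-] := aI i; elim/tsum_ind: (r i) => s; rewrite mulrC tens_mul_tsum.
rewrite tcoord_tsum; apply/colP => j; rewrite !mxE /scoord big_map big1 // => p _.
by rewrite loc_pi0 ?k0 ?rmorph0 ?mul0r // mulrC; apply: idealM.
Qed.

(** Lifts of the coordinate vectors: they make [tcoord] surjective, and the last property shows that
    its kernel lies in [L]. With [e i = x i / s i], the multiple [c] of the [i]-th vector lifts to
    the tensor of [x i] and [rho (1 / s i) * c]. *)
Lemma tcoord_section : {g : 'I_n -> C -> F |
  [/\ forall i c, tcoord (g i c) = c *: delta_mx i 0,
      forall i, g i 0 = 0 &
      forall z, z - \sum_i g i (tcoord z i 0) \in (L : {pred F})]}.
Proof.
apply: (@cid ('I_n -> C -> F)).
have /choice[p pE] : forall i, exists p : B * denom S, e i = loc_frac (mquot_pi p.1) p.2.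
  move=> i; elim/loc_ind: (e i) => x s; elim/rquot_ind: x => b.
  by exists (b, s).
pose x i := (p i).1; pose s i := (p i).2.
have eE i : loc_pi (x i) = loc_map S (sval (s i)) *: e i.
  rewrite /loc_pi pE loc_fracZ; apply: loc_frac_eq.
  by rewrite /= mul1r scale1r.
pose g i c := tens phi psi (x i) (rho (ring_frac 1 (s i)) * c).
exists g; split=> [i c|i|]; last 1 first.
- elim/tsum_ind; elim=> [|[b c] z IH].
    rewrite -[tsum _ _ _]/(0 : F) tcoord0 big1 ?subr0 ?rpred0 // => i _.
    by rewrite mxE /g mulr0 tens0r.
  rewrite -cat1s -tsum_add tcoordD.
  under eq_bigr do rewrite mxE /g mulrDr tens_addr.
  rewrite big_split opprD addrACA; apply: rpredD IH.
  (* In terms of the [x i], the class of [b] has coefficients [k_i / s i], brought here to a common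
     denominator [t]. *)
  have [t [a aE]] := common_denom (fun i => k (loc_pi b) i * ring_frac 1 (s i)).
  have : loc_pi b = loc_frac (\sum_i mquot_pi (phi (a i) * x i)) t.
    rewrite {1}[loc_pi b]kE loc_frac_sumr; apply: eq_bigr => i _.
    transitivity (ring_frac (a i) t *: loc_pi (x i)).
      by rewrite -aE eE scalerA -mulrA [ring_frac _ _ * _]mulrC loc_mapK mulr1.
    rewrite loc_fracZ mquot_piZ; apply: loc_frac_eq.
    by rewrite /= mulr1.
  rewrite -mquot_pi_sum => /loc_frac_eqP[w Sw].
  rewrite /= mulr1 -!mquot_piZ => /rquot_eqP; rewrite -mulNr -rmorphN mulr_sumr.
  pose sw : denom S := exist _ w Sw.
  (* Clearing denominators leaves an element of [I] in which [b] has the factor [w * t]. Tensoring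
     with this [d] cancels that factor and leaves the tensor of [b] and [c]. *)
  pose d := rho (ring_frac 1 t * ring_frac 1 sw) * c.
  move=> /(@tens_ideal _ d); rewrite tens_addl tens_suml tens_balanced => Lz.
  apply: etrans Lz; apply: (congr1 (fun z => z \in (L : {pred F}))).
  congr (_ + _).
    rewrite -rho_map /d mulrA -rmorphM (_ : loc_map S _ * _ = 1) ?rmorph1 ?mul1r //.
    by rewrite rmorphM [ring_frac 1 t * _]mulrC mulrACA (loc_mapK sw) loc_mapK mulr1.
  rewrite -sumrN; apply: eq_bigr => i _.
  rewrite !tens_balanced -tensNr tcoord_tsum mxE /scoord big_seq1 /= mulrA -rmorphM.
  rewrite [ring_frac 1 _ * _]mulrC aE /d -!rho_map ring_fracE; congr tens.
  have rw : rho (loc_map S w) * rho (ring_frac 1 sw) = 1.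
    by rewrite -rmorphM (loc_mapK sw) rmorph1.
  by rewrite !rmorphN !rmorphM /=; ring: rw.
- rewrite /g /tens tcoord_tsum; apply/colP => j; rewrite !mxE /scoord big_seq1 /=.
  (* The class of [x i] is [s i] times [e i], so its only possibly nonzero coordinate cancels
     against [1 / s i]. *)
  rewrite (k_uniq (c := fun j => loc_map S (sval (s i)) *+ (j == i))); last first.
    rewrite eE (bigD1 i) //= eqxx big1 ?addr0 // => l /negPf ->.
    by rewrite mulr0n scale0r.
  rewrite eqxx andbT mulrA -rmorphM; case: (j == i) => /=; last first.
    by rewrite mulr0n mul0r rmorph0 mul0r mulr0.
  by rewrite mulr1n loc_mapK rmorph1 mul1r mulr1.
- by rewrite /g mulr0 tens0r.
Qed.

Lemma tcoord_idealP z : z \in (L : {pred F}) <-> tcoord z = 0.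
Proof.
split=> [|z0]; first exact: tcoord_ideal.
have [g [_ g0 /(_ z)]] := tcoord_section.
by rewrite z0 big1 ?subr0 // => i _; rewrite mxE g0.
Qed.

(** Through [tcoord], the quotient by [L] is [C^n], and multiplication by [b] is the reduced
    matrix. *)
Lemma regular_denominators_mx b m :
  represents (loc_end (mul_endo phi I b)) e m ->
  regular_denominators L (tens phi psi b 1) <->
  forall v : 'cV[C]_n, map_mx rho m *m v = 0 -> v = 0.
Proof.
move=> em; rewrite regular_denominatorsP; split=> [h v mv|h x].
  have [g [gE _ _]] := tcoord_section.
  pose x := \sum_i g i (v i 0).
  have xE : tcoord x = v.
    rewrite tcoord_sum [RHS]matrix_sum_delta; apply: eq_bigr => i _.
    by rewrite big_ord1 gE.
  rewrite -xE; apply/tcoord_idealP/h/tcoord_idealP.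
  by rewrite (tcoord_mul _ em) xE.
by rewrite !tcoord_idealP (tcoord_mul _ em) => /h.
Qed.

End BaseChange.

(** * The residue field at a prime, and injective matrices over a field *)

Section ResidueFieldTheory.
Variables (A : comPzRingType) (P : spec A).

Lemma prime_ext_frac (x : loc_prime P) : x \in prime_ext P ->
  exists2 p, p \in (P : {pred A}) & exists s : denom (prime_compl P), x = ring_frac p s.
Proof.
move=> /asboolP[n [r [a [aP ->]]]].
have [s [c cE]] := common_denom r.
have /choice[p pE] : forall i, exists q, q \in (P : {pred A}) /\ loc_map _ q = a i.
  by move=> i; have [q qP qE] := aP i; exists q.
exists (\sum_i c i * p i).
  by apply: rpred_sum => i _; apply: idealM; case: (pE i).
exists s; rewrite /ring_frac loc_frac_sumr; apply: eq_bigr => i _.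
have [_ <-] := pE i; rewrite cE; apply: etrans (ring_fracM _ _ _ _) _.
by apply: ring_frac_eq; rewrite /= mulr1.
Qed.

(** If [a/1 = p/s] with [p] in [P], then [u * s * a] is in [P] while [u] and [s] are not, so
    primality applies to [a]. *)
Lemma residue_map_eq0 a : residue_map P a = 0 <-> a \in (P : {pred A}).
Proof.
split=> [h|aP].
  have : loc_map (prime_compl P) a - 0 \in prime_ext P.
    by apply/rquot_eqP; rewrite rmorph0.
  rewrite subr0 => /prime_ext_frac[p pP [s /ring_frac_eqP[u uP /= e]]].
  have : u * sval s * a \in (P : {pred A}) by rewrite e; apply: idealM.
  by move=> /spec_prime/orP[/spec_prime/orP[]|//]; apply/contraTT => _;
    [exact: uP | exact: (svalP s)].
rewrite -(rmorph0 (rquot_pi (prime_ext P))); apply/rquot_eqP; rewrite subr0.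
by apply: subset_ideal_gen; exists a.
Qed.

Lemma residue_field_neq0 : (1 : residue_field P) != 0.
Proof.
apply/eqP; rewrite -(rmorph1 (@residue_map A P)) => /residue_map_eq0.
exact/negP/spec_proper.
Qed.

(** A nonzero class has a representative [a/s] with [a] outside [P], so [s/a] is an inverse. The
    value 0 at 0 is the field structure's convention. *)
Lemma residue_field_inv (x : residue_field P) :
  exists y, (x != 0 -> y * x = 1) /\ (x = 0 -> y = 0).
Proof.
have [->|x0] := eqVneq x 0; first by exists 0.
suff [y yE] : exists y, y * x = 1 by exists y; split=> // /eqP; rewrite (negPf x0).
move: x0; elim/rquot_ind: x; elim/loc_ind=> a s x0.
have aP : a \in @prime_compl A P.
  apply/negP => aP; move/negP: x0; apply; apply/eqP.
  rewrite -(rmorph0 (rquot_pi (prime_ext P))); apply/rquot_eqP; rewrite subr0.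
  rewrite -[loc_frac _ _]/(ring_frac _ _) ring_fracE mulrC; apply: idealM.
  by apply: subset_ideal_gen; exists a.
pose a' : denom (prime_compl P) := exist _ a aP.
exists (rquot_pi (prime_ext P) (ring_frac (sval s) a')).
rewrite -rmorphM -(rmorph1 (rquot_pi (prime_ext P))); congr rquot_pi.
apply: etrans (ring_fracM _ _ _ _) _; rewrite -(ring_fracK (denomM a' s)).
by apply: ring_frac_eq; rewrite /= [sval s * a]mulrC.
Qed.

Definition residue_inv x := sval (cid (residue_field_inv x)).

Lemma residue_mulVf x : x != 0 -> residue_inv x * x = 1.
Proof. by have [] := svalP (cid (residue_field_inv x)). Qed.

Lemma residue_inv0 : residue_inv 0 = 0.
Proof. by case: (svalP (cid (residue_field_inv 0))) => _; apply. Qed.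

HB.instance Definition _ :=
  GRing.PzSemiRing_isNonZero.Build (residue_field P) residue_field_neq0.
HB.instance Definition _ :=
  GRing.ComNzRing_isField.Build (residue_field P) residue_mulVf residue_inv0.


End ResidueFieldTheory.

(** A vanishing determinant yields a kernel vector, after transposing since [det0P] concerns row
    vectors; conversely the adjugate turns [m *m v = 0] into [\det m *: v = 0]. *)
Lemma mulmx_inj_det (K : fieldType) n (m : 'M[K]_n) :
  (forall v : 'cV_n, m *m v = 0 -> v = 0) <-> \det m != 0.
Proof.
split=> [h|d0 v mv].
  rewrite -det_tr; apply/det0P => -[v v0 vm]; move/negP: v0; apply; apply/eqP.
  by apply: trmx_inj; rewrite trmx0; apply: h; rewrite -[m]trmxK -trmx_mul vm trmx0.
apply: (scalerI d0); rewrite scaler0 -mul_scalar_mx -mul_adj_mx -mulmxA mv.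
exact: mulmx0.
Qed.

(** * The locus as a basic open set *)

Theorem proposition4p2 (A B : comPzRingType) (phi : {rmorphism A -> B})
    (I : idealType B) (b : B) :
  finite_locally_free (mquot phi I) ->
  open (locus phi I b) /\
  locus phi I b = basic_open (loc_det (mul_endo phi I b)).
Proof.
case=> _ lf; set d := loc_det _.
suff UE : locus phi I b = basic_open d.
  (* A basic open set is the complement of the zeros of a single element. *)
  split=> //; rewrite UE; exists [set d]; apply/seteqP; split=> P /=.
    by move=> dP /(_ d erefl); apply/negP.
  by move=> nP; apply/negP => dP; apply: nP => _ ->.
apply/predeqP => P; have [f fP [n [e be]]] := lf P.
have [m em] := represents_exists (loc_end (mul_endo phi I b)) be.
have dm : loc_map (powers f) d = \det m by apply: loc_det_is_det lf _ _ _ _ be em.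
have ST : {subset powers f <= @prime_compl A P} by exact: avoids_powers.
(* Since [f] is outside [P], the map from [A] to the residue field factors through [A_f], where the
   basis lives. *)
pose rho : {rmorphism @loc_ring A (powers f) -> residue_field P} :=
  rquot_pi (prime_ext P) \o ring_incl ST.
have rhoE a : rho (loc_map (powers f) a) = residue_map P a.
  by rewrite /rho /= ring_incl_map.
have LE z : (z \in (fiber_ideal phi I P : {pred _})) = (z \in ideal_gen
  [set tens phi (residue_map P) x 1 | x in [set` (I : {pred B})]]) by [].
apply: iff_trans (regular_denominators_mx rhoE be LE em) _.
(* The determinant of the reduced matrix is the image of [d] in the residue field, which vanishes
   exactly when [d] is in [P]. *)
apply: iff_trans (mulmx_inj_det (map_mx rho m)) _; rewrite det_map_mx -dm rhoE.
split=> [/eqP h|/negP h]; first by apply/negP => /residue_map_eq0.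
by apply/eqP => /residue_map_eq0.
Qed.
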